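(* Let $l>1$ be an integer, let $e_1,\dots,e_{l+1}$ and $o_1,\dots,o_l$ be positive integers, and let $n$ be a positive even integer such that $$(E^{e_1}\circ O^{o_1}\circ E^{e_2}\circ\dotsb\circ O^{o_l}\circ E^{e_{l+1}})(n)=1.$$ Let $\sigma_e=e_1+\dots+e_{l+1}$ and $\sigma_o=o_1+\dots+o_l$. Then $$(E^{e_1}\circ O^{o_1}\circ E^{e_2}\circ\dotsb\circ O^{o_l}\circ E^{e_{l+1}})(n)=\lceil (E^{\sigma_e}\circ O^{\sigma_o})(n)\rceil.$$
   Context: $E$ and $O$ are the functions $E(n)=n/2$ and $O(n)=(3n+1)/2$ on positive rational numbers. Exponents on functions denote repeated composition ($E^k=E\circ\dotsb\circ E$, $k$ times), and $(A\circ B)(n)=A(B(n))$. The composition in the claim alternates $E^{e_i}$ and $O^{o_i}$ for $i=1,\dots,l$ from left to right and ends with $E^{e_{l+1}}$ on the right (which is applied first). $\lceil x\rceil$ is the least integer that is at least $x$. *)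

(* Defs.v *)
From HB Require Import structures.
From mathcomp Require Import all_boot all_order all_algebra.
Set Implicit Arguments.
Unset Strict Implicit.
Unset Printing Implicit Defensive.
Import Order.TTheory GRing.Theory Num.Theory.
Local Open Scope ring_scope.

(* E and O act on the positive rationals; here they are extended by the same
   formulas to all of rat. They preserve positivity, so on positive arguments
   nothing changes. No parity condition is attached to either map. *)
Definition E (x : rat) : rat := x / 2.

Definition O (x : rat) : rat := (3 * x + 1) / 2.

(* E^(e 1) \o O^(o 1) \o ... \o E^(e l) \o O^(o l) \o E^(e l.+1).
   Indices start at 1; values of e outside 1..l.+1 and of o outside 1..l are
   irrelevant. The product is ordered, with the factor of index 1 outermost. *)
Definition EO_comp (l : nat) (e o : nat -> nat) : rat -> rat :=
  \big[(fun f g : rat -> rat => f \o g)/id]_(1 <= i < l.+1)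
     (iter (e i) E \o iter (o i) O)
  \o iter (e l.+1) E.

(* Main.v *)
(* E (O x) = 3x/4 + 1/4 <= 3x/4 + 1/2 = O (E x), so moving every O to the right
   of every E can only decrease the value of a composition of these monotone
   maps. Hence E^sigma_e (O^sigma_o n) lies in ]0, 1], and its ceiling is 1. *)
Require Import Defs.
From HB Require Import structures.
From mathcomp Require Import all_boot all_order all_algebra lra.
Set Implicit Arguments.
Unset Strict Implicit.
Unset Printing Implicit Defensive.
Import Order.TTheory GRing.Theory Num.Theory.
Local Open Scope ring_scope.

Lemma E_mono : {homo E : x y / x <= y}.
Proof. by move=> x y; rewrite /E; lra. Qed.

Lemma O_mono : {homo O : x y / x <= y}.
Proof. by move=> x y; rewrite /O; lra. Qed.

Lemma iter_E_mono a : {homo iter a E : x y / x <= y}.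
Proof. by move=> x y xy; elim: a => //= a; apply: E_mono. Qed.

Lemma iter_O_mono b : {homo iter b O : x y / x <= y}.
Proof. by move=> x y xy; elim: b => //= b; apply: O_mono. Qed.

Lemma E_iter_O_le b x : E (iter b O x) <= iter b O (E x).
Proof.
elim: b => //= b IHb; apply: le_trans (O_mono IHb).
(* What remains is the single swap [E (O y) <= O (E y)] at [y = iter b O x], which holds with slack
   1/4. *)
by rewrite /E /O; lra.
Qed.

Lemma iter_E_iter_O_le a b x : iter a E (iter b O x) <= iter b O (iter a E x).
Proof.
by elim: a => //= a IHa; apply: le_trans (E_mono IHa) (E_iter_O_le _ _).
Qed.

(** Induction on [r]: the head's [E] block is outermost on both sides and cancels by monotonicity;
    the tail's [E] block is then moved inside the head's [O] block, where the induction hypothesis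
    applies. *)
Lemma iter_E_iter_O_sum_le (r : seq nat) (e o : nat -> nat) x :
  iter (\sum_(i <- r) e i) E (iter (\sum_(i <- r) o i) O x)
    <= (\big[(fun f g : rat -> rat => f \o g)/id]_(i <- r)
         (iter (e i) E \o iter (o i) O)) x.
Proof.
elim: r => [|i r IHr]; first by rewrite !big_nil.
rewrite !big_cons /= !iterD; apply: iter_E_mono.
by apply: le_trans (iter_E_iter_O_le _ _ _) _; apply: iter_O_mono.
Qed.

Lemma EO_comp_ge l e o x :
  iter (\sum_(1 <= i < l.+2) e i) E (iter (\sum_(1 <= i < l.+1) o i) O x)
    <= EO_comp l e o x.
Proof.
(* The exponent [e l.+1] is split off because its block has no [O] factor after it; it must cross
   all the [O]s to become the innermost block. *)
rewrite big_nat_recr //= iterD /EO_comp /=.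
apply: le_trans (iter_E_iter_O_sum_le _ _ _ _).
by apply: iter_E_mono; apply: iter_E_iter_O_le.
Qed.

Lemma iter_E_iter_O_gt0 a b x : 0 < x -> 0 < iter a E (iter b O x).
Proof.
move=> x_gt0; have: 0 < iter b O x.
  by elim: b => //= b; rewrite /O; lra.
by elim: a => //= a IHa /IHa; rewrite /E; lra.
Qed.

Theorem corollary1 (l : nat) (e o : nat -> nat) (n : nat)
  (hl : (1 < l)%N)
  (he : forall i : nat, (1 <= i <= l.+1)%N -> (0 < e i)%N)
  (ho : forall i : nat, (1 <= i <= l)%N -> (0 < o i)%N)
  (hn : (0 < n)%N)
  (hn_even : ~~ odd n)
  (hcomp : EO_comp l e o n%:R = 1) :
  let sigma_e := (\sum_(1 <= i < l.+2) e i)%N in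
  let sigma_o := (\sum_(1 <= i < l.+1) o i)%N in
  EO_comp l e o n%:R
    = (Num.ceil ((iter sigma_e E \o iter sigma_o O) n%:R))%:~R.
Proof.
move=> sigma_e sigma_o; rewrite hcomp.
have le1 := EO_comp_ge l e o n%:R; rewrite hcomp in le1.
(* The ceiling is 1 once the value lies in ]0, 1]: [le1] is the upper bound, and positivity of [n]
   gives the lower one. *)
rewrite (@ceil_def _ _ 1) // subrr le1 andbT.
by apply: iter_E_iter_O_gt0; rewrite ltr0n.
Qed.
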